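(* Let $a>0$, $b>0$. Then $\left(a,\,b,\,3a+\frac12-b\right)\in\mathcal{P}_{1,2}$ if and only if $a\ne\frac12$ and $b$ lies strictly between $a+\frac12$ and $2a$. Moreover, in this case, for all $x>0$, $${}_1F_2\left(a\,;b,\,3a+\tfrac12-b\,;-\tfrac{x^2}{4}\right)>\mathbb{J}_{a-\frac12}^2\left(\frac{x}{2}\right).$$
   Context: For $a,b,c>0$, ${}_1F_2\left(a\,;b,c\,;-\frac{x^2}{4}\right)=\sum_{k=0}^\infty \frac{(a)_k}{k!\,(b)_k(c)_k}\left(-\frac{x^2}{4}\right)^k$, where $(\alpha)_k=\Gamma(\alpha+k)/\Gamma(\alpha)$. $\mathcal{P}_{1,2}$ denotes the set of all triples $(a,b,c)$ of positive reals such that this function is $>0$ for all $x>0$. For $\alpha>-1$, $\mathbb{J}_\alpha(x)={}_0F_1\left(\alpha+1\,;-\frac{x^2}{4}\right)=\Gamma(\alpha+1)(x/2)^{-\alpha}J_\alpha(x)$, with $J_\alpha$ the Bessel function of the first kind. *)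

(* Defs.v *)
From Stdlib Require Import Reals.
From Coquelicot Require Import Coquelicot.
Open Scope R_scope.

Fixpoint poch (alpha : R) (k : nat) : R :=
  match k with
  | O => 1
  | S k' => poch alpha k' * (alpha + INR k')
  end.

Definition F12 (a b c x : R) : R :=
  Series (fun k => poch a k / (INR (Factorial.fact k) * poch b k * poch c k)
                   * (- x ^ 2 / 4) ^ k).

Definition P12 (a b c : R) : Prop :=
  0 < a /\ 0 < b /\ 0 < c /\ forall x : R, 0 < x -> 0 < F12 a b c x.

(* normalized Bessel function  JJ_alpha(x) = 0F1(alpha+1; -x^2/4) *)
Definition JJ (alpha x : R) : R :=
  Series (fun k => / (INR (Factorial.fact k) * poch (alpha + 1) k) * (- x ^ 2 / 4) ^ k).

(* Main.v *)
Require Import Defs.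
From Stdlib Require Import Reals Factorial Lra Lia.
From Coquelicot Require Import Coquelicot.
Open Scope R_scope.

(** Put [c = 3a + 1/2 - b]; the condition on [b] says [(2a - b) (2a - c) > 0]. On the line
    [b + c = 3a + 1/2], Gasper's expansion of [F12 a b c x] in the squares [JJ (a - 1/2 + n) (x/2) ^ 2]
    starts with [JJ (a - 1/2) (x/2) ^ 2] and has coefficients of the sign of
    [(2a - b)_n (2a - c)_n], by Dougall's [5F4] sum. If [(2a - b) (2a - c) > 0], all of them are
    positive. If [(2a - b) (2a - c) <= 0] and both factors exceed [-1], all coefficients with [n >= 1]
    are nonpositive, so [F12] is nonpositive where [JJ (a - 1/2) (x/2)] vanishes. Otherwise [b <= a]
    or [c <= a]; say [c <= a]. Raising a lower parameter preserves nonnegativity, so positivity of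
    [F12 a b c] would pass to [F12 a b a = JJ (b - 1)], which oscillates. *)

(** * Pochhammer symbols: identities and bounds *)

Lemma poch_pos (x : R) (n : nat) : 0 < x -> 0 < poch x n.
Proof.
  intros hx. induction n as [|n IH]; simpl; [lra|].
  pose proof (pos_INR n). apply Rmult_lt_0_compat; lra.
Qed.

Lemma poch_add (x : R) (m n : nat) :
  poch x (m + n) = poch x m * poch (x + INR m) n.
Proof.
  induction n as [|n IH].
  - rewrite Nat.add_0_r. simpl. ring.
  - rewrite Nat.add_succ_r. simpl. rewrite IH, plus_INR. ring.
Qed.

Lemma poch_S_l (x : R) (n : nat) : poch x (S n) = x * poch (x + 1) n.
Proof.
  rewrite <- (Nat.add_1_l n), poch_add. simpl. ring.
Qed.

Lemma poch_1 (n : nat) : poch 1 n = INR (fact n).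
Proof.
  induction n as [|n IH]; [reflexivity|].
  cbn [poch]. rewrite IH, fact_simpl, mult_INR, S_INR. ring.
Qed.

(** Duplication: the factors of even and odd index are [2 * (x + j)] and [2 * (x + 1 / 2 + j)]. *)
Lemma poch_double (x : R) (n : nat) :
  poch (2 * x) (n + n) = 4 ^ n * poch x n * poch (x + 1 / 2) n.
Proof.
  induction n as [|n IH]; [simpl; ring|].
  replace (S n + S n)%nat with (S (S (n + n))) by lia.
  cbn [poch]. rewrite IH, S_INR, plus_INR. simpl. field.
Qed.

Lemma poch_opp_nat_eq0 (k n : nat) : (k < n)%nat -> poch (- INR k) n = 0.
Proof.
  intros h. replace n with (S k + (n - S k))%nat by lia.
  rewrite poch_add. simpl. ring.
Qed.

(** Read backwards, the factors on the left are the negatives of those of [poch x n]. *)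
Lemma poch_reverse (x : R) (n : nat) :
  poch (1 - x - INR n) n = (- 1) ^ n * poch x n.
Proof.
  revert x. induction n as [|n IH]; intros x; [simpl; ring|].
  rewrite poch_S_l, S_INR.
  replace (1 - x - (INR n + 1) + 1) with (1 - x - INR n) by ring.
  rewrite IH. simpl. ring.
Qed.

(** This is $(-k)_n = (-1)^n k!/(k-n)!$ with [k = n + j], free of division and truncated
    subtraction. *)
Lemma poch_opp_nat (n j : nat) :
  poch (- INR (n + j)) n * INR (fact j) = (- 1) ^ n * INR (fact (n + j)).
Proof.
  replace (- INR (n + j)) with (1 - (1 + INR j) - INR n) by (rewrite plus_INR; ring).
  rewrite poch_reverse, <- !poch_1, (Nat.add_comm n j), poch_add. ring.
Qed.

(** Factor by factor: $|x+i| \le |x|+i \le (|x|/y+1)(y+i)$. *)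
Lemma poch_le_geom (x y : R) (n : nat) :
  0 < y -> Rabs (poch x n) <= (Rabs x / y + 1) ^ n * poch y n.
Proof.
  intros hy. induction n as [|n IH].
  - simpl. rewrite Rabs_R1. lra.
  - cbn [poch pow]. rewrite Rabs_mult.
    pose proof (pos_INR n) as hn. pose proof (Rabs_pos x) as hx.
    assert (h0 : 0 <= Rabs x / y) by (apply Rmult_le_pos; [lra | left; now apply Rinv_0_lt_compat]).
    assert (h : Rabs (x + INR n) <= (Rabs x / y + 1) * (y + INR n)).
    { eapply Rle_trans; [apply Rabs_triang|]. rewrite (Rabs_pos_eq (INR n)) by lra.
      replace ((Rabs x / y + 1) * (y + INR n)) with
        (Rabs x + INR n + (Rabs x / y * INR n + y)) by (field; lra).
      assert (0 <= Rabs x / y * INR n) by (apply Rmult_le_pos; lra). lra. }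
    eapply Rle_trans; [apply Rmult_le_compat; [apply Rabs_pos | apply Rabs_pos | exact IH | exact h]|].
    right. ring.
Qed.

Lemma pow_le_poch (x : R) (n : nat) : 0 < x -> x ^ n <= poch x n.
Proof.
  intros hx. induction n as [|n IH]; [simpl; lra|].
  cbn [poch pow]. rewrite Rmult_comm. pose proof (pos_INR n).
  apply Rmult_le_compat; try lra. apply pow_le; lra.
Qed.

(** * Entire power series of exponential type *)

(** One growth condition that covers all the hypergeometric series below and survives geometric
    factors and termwise domination; it settles every convergence question. *)
Definition exp_bounded (u : nat -> R) : Prop :=
  exists K M : R, 0 <= K /\ 0 <= M /\ forall k, Rabs (u k) <= K * M ^ k / INR (fact k).

Lemma ex_series_exp_type (K r : R) : ex_series (fun k => K * r ^ k / INR (fact k)).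
Proof.
  apply (ex_series_ext (fun k => scal K (scal (r ^ k) (/ INR (fact k))))).
  - intros k. unfold scal; simpl; unfold mult; simpl. field. apply INR_fact_neq_0.
  - apply (@ex_series_scal R_AbsRing R_NormedModule). exists (exp r). apply is_exp_Reals.
Qed.

(** Beyond a finite radius the terms would not tend to 0, whereas the exponential series dominates
    them everywhere. *)
Lemma CV_radius_exp_bounded (u : nat -> R) : exp_bounded u -> CV_radius u = p_infty.
Proof.
  intros (K & M & hK & hM & h).
  assert (hle : forall r : R, 0 <= r -> ~ Rbar_lt (CV_radius u) (Finite r)).
  { intros r hr hlt. apply (CV_disk_outside u r).
    - now rewrite (Rabs_pos_eq r hr).
    - apply ex_series_lim_0.
      apply (@ex_series_le R_AbsRing R_CompleteNormedModule _
               (fun k => K * (M * r) ^ k / INR (fact k))); [|apply ex_series_exp_type].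
      intros k. unfold norm; simpl; unfold abs; simpl.
      rewrite Rabs_mult, <- RPow_abs, (Rabs_pos_eq r hr), Rpow_mult_distr.
      replace (K * (M ^ k * r ^ k) / INR (fact k)) with (K * M ^ k / INR (fact k) * r ^ k)
        by (field; apply INR_fact_neq_0).
      apply Rmult_le_compat_r; [now apply pow_le | apply h]. }
  pose proof (CV_radius_ge_0 u) as h0.
  destruct (CV_radius u) as [l| |]; simpl in *; [exfalso| reflexivity | contradiction].
  apply (hle (l + 1)); lra.
Qed.

Lemma exp_bounded_inside (u : nat -> R) (z : R) :
  exp_bounded u -> Rbar_lt (Finite (Rabs z)) (CV_radius u).
Proof. intros h. now rewrite CV_radius_exp_bounded. Qed.

Lemma exp_bounded_le (u v : nat -> R) :
  exp_bounded u -> (forall k, Rabs (v k) <= Rabs (u k)) -> exp_bounded v.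
Proof.
  intros (K & M & hK & hM & h) hv. exists K, M. repeat split; auto.
  intros k. eapply Rle_trans; [apply hv | apply h].
Qed.

Lemma exp_bounded_series (u : nat -> R) (z : R) :
  exp_bounded u -> ex_series (fun k => Rabs (u k * z ^ k)).
Proof. intros h. now apply CV_disk_inside, exp_bounded_inside. Qed.

(** * Dominated convergence for series *)

(** Tannery's theorem: a finite head converges termwise, and the tail of the differences is at most
    the tail of [2 * M]. *)
Lemma series_dominated_convergence (f : nat -> nat -> R) (g M : nat -> R) :
  ex_series M -> (forall N k, Rabs (f N k) <= M k) ->
  (forall k, is_lim_seq (fun N => f N k) (g k)) ->
  is_lim_seq (fun N => Series (f N)) (Series g).
Proof.
  intros hM hf hg.
  assert (hgM : forall k, Rabs (g k) <= M k).
  { intros k. apply (is_lim_seq_le (fun N => Rabs (f N k)) (fun _ => M k) (Rabs (g k)) (M k)).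
    - intros N. apply hf.
    - apply (is_lim_seq_abs _ (g k)), hg.
    - apply is_lim_seq_const. }
  pose (h := fun N k => Rabs (f N k - g k)).
  assert (hh : forall N k, 0 <= h N k <= 2 * M k).
  { intros N k. unfold h. split; [apply Rabs_pos|].
    specialize (hf N k). specialize (hgM k).
    eapply Rle_trans; [apply Rabs_triang|]. rewrite Rabs_Ropp. lra. }
  assert (h2M : ex_series (fun k => 2 * M k)) by now apply (@ex_series_scal R_AbsRing R_NormedModule).
  assert (hhs : forall N, ex_series (h N)).
  { intros N. apply (@ex_series_le R_AbsRing R_CompleteNormedModule _ (fun k => 2 * M k)); [|exact h2M].
    intros k. unfold norm; simpl; unfold abs; simpl.
    rewrite Rabs_pos_eq; apply hh. }
  assert (exf : forall N, ex_series (f N)).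
  { intros N. apply (@ex_series_le R_AbsRing R_CompleteNormedModule _ M); [|exact hM]. apply hf. }
  assert (exg : ex_series g).
  { apply (@ex_series_le R_AbsRing R_CompleteNormedModule _ M); [|exact hM]. apply hgM. }
  apply is_lim_seq_spec. intros eps.
  assert (he : 0 < eps / 2) by (destruct eps; simpl; lra).
  (* [m] is chosen so that the tail of [2 * M] beyond it is below [eps / 2]; the head up to [m] gets
     the other half. *)
  pose proof (Series_correct _ h2M) as hlim.
  apply (is_lim_seq_spec _ (Finite _)) in hlim.
  destruct (hlim (mkposreal _ he)) as [m hm]. specialize (hm m (le_n m)). simpl in hm.
  assert (hfin : is_lim_seq (fun N => sum_n (h N) m) 0).
  { clear hm. induction m as [|m IH].
    - apply (is_lim_seq_ext (fun N => Rabs (f N 0%nat - g 0%nat))); [intros; now rewrite sum_O|].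
      rewrite <- Rabs_R0. apply (is_lim_seq_abs _ (Finite 0)).
      replace 0 with (g 0%nat - g 0%nat) by ring.
      apply is_lim_seq_minus'; [apply hg | apply is_lim_seq_const].
    - apply (is_lim_seq_ext (fun N => sum_n (h N) m + Rabs (f N (S m) - g (S m))));
        [intros; now rewrite sum_Sn|].
      replace 0 with (0 + Rabs (g (S m) - g (S m))) by (rewrite Rminus_diag, Rabs_R0; ring).
      apply is_lim_seq_plus'; [exact IH|].
      apply (is_lim_seq_abs _ (Finite _)).
      apply is_lim_seq_minus'; [apply hg | apply is_lim_seq_const]. }
  apply (is_lim_seq_spec _ (Finite _)) in hfin.
  destruct (hfin (mkposreal _ he)) as [N0 hN0]. simpl in hN0.
  exists N0. intros N hN. specialize (hN0 N hN). rewrite Rminus_0_r in hN0.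
  rewrite <- Series_minus by auto.
  eapply Rle_lt_trans; [apply Series_Rabs, hhs|].
  change (Series (h N) < eps).
  rewrite (Series_incr_n (h N) (S m)) by (auto; lia).
  rewrite (Series_incr_n (fun k => 2 * M k) (S m)) in hm by (auto; lia).
  simpl pred in *. rewrite sum_n_Reals in hm, hN0.
  assert (hle : Series (fun k => h N (S m + k)%nat) <= Series (fun k => 2 * M (S m + k)%nat)).
  { apply Series_le; [intros; apply hh|]. now apply (ex_series_incr_n (fun k => 2 * M k)). }
  apply Rabs_def2 in hm. apply Rabs_def2 in hN0. lra.
Qed.

Lemma PSeries_dominated_convergence (f : nat -> nat -> R) (g u : nat -> R) (z : R) :
  exp_bounded u -> (forall N k, Rabs (f N k) <= Rabs (u k)) ->
  (forall k, is_lim_seq (fun N => f N k) (g k)) ->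
  is_lim_seq (fun N => PSeries (f N) z) (PSeries g z).
Proof.
  intros hu hf hg.
  apply (series_dominated_convergence (fun N k => f N k * z ^ k) (fun k => g k * z ^ k)
           (fun k => Rabs (u k * z ^ k))).
  - now apply exp_bounded_series.
  - intros N k. rewrite !Rabs_mult. apply Rmult_le_compat_r; [apply Rabs_pos | apply hf].
  - intros k. apply (is_lim_seq_scal_r _ (z ^ k) (Finite (g k))), hg.
Qed.

(** * Positivity under averaging and under raising a lower parameter *)

(* [PSeries v] is the average [s * int_0^1 t^(s-1) PSeries u (t * z) dt], so
   [r^s * PSeries v (-r)] has derivative [s * r^(s-1) * PSeries u (-r)]. *)
Lemma PSeries_average_pos (u : nat -> R) (s : R) :
  0 < s -> exp_bounded u -> 0 < u 0%nat ->
  (forall z, z < 0 -> 0 <= PSeries u z) ->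
  forall z, z < 0 -> 0 < PSeries (fun k => u k * (s / (s + INR k))) z.
Proof.
  intros hs hu hu0 hpos z hz.
  set (v := fun k => u k * (s / (s + INR k))).
  assert (hv : exp_bounded v).
  { apply (exp_bounded_le u); [exact hu|]. intros k. unfold v. rewrite Rabs_mult.
    pose proof (pos_INR k) as hk.
    rewrite <- (Rmult_1_r (Rabs (u k))) at 2.
    apply Rmult_le_compat_l; [apply Rabs_pos|].
    rewrite Rabs_pos_eq by (apply Rmult_le_pos; [lra | left; apply Rinv_0_lt_compat; lra]).
    apply Rle_div_l; lra. }
  (* Coefficientwise this is [(k + s) * v k = s * u k]. *)
  assert (hode : forall y, y * PSeries (PS_derive v) y + s * PSeries v y = s * PSeries u y).
  { intros y. rewrite <- PSeries_incr_1, <- !PSeries_scal, <- PSeries_plus.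
    - apply PSeries_ext. intros k. match goal with |- ?l = ?r => change (@eq R l r) end.
      unfold PS_plus, PS_incr_1, PS_scal, PS_derive, plus, scal, zero; cbn -[INR]; unfold mult; cbn -[INR].
      pose proof (pos_INR k) as hk. unfold v.
      destruct k as [|k]; [simpl; field; lra|]. rewrite S_INR in *. field; lra.
    - apply ex_pseries_incr_1, CV_radius_inside. rewrite CV_radius_derive.
      now apply exp_bounded_inside.
    - apply ex_pseries_scal; [apply Rmult_comm|]. now apply CV_radius_inside, exp_bounded_inside. }
  pose (phi := fun r => exp (s * ln r) * PSeries v (- r)).
  assert (hder : forall r, 0 < r ->
    is_derive phi r (s * exp (s * ln r) / r * PSeries u (- r))).
  { intros r hr. unfold phi.
    replace (s * exp (s * ln r) / r * PSeries u (- r)) with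
      (s / r * exp (s * ln r) * PSeries v (- r)
       + exp (s * ln r) * (- 1 * PSeries (PS_derive v) (- r))).
    - apply (is_derive_mult (fun r => exp (s * ln r)) (fun r => PSeries v (- r))).
      + auto_derive; [exact hr|]. field. lra.
      + apply (is_derive_comp (PSeries v) Ropp).
        * apply is_derive_PSeries. now apply exp_bounded_inside.
        * auto_derive; [exact I|]. ring.
      + intros; apply Rmult_comm.
    - replace (s * exp (s * ln r) / r * PSeries u (- r)) with
        (exp (s * ln r) / r * (s * PSeries u (- r))) by (field; lra).
      rewrite <- hode. field. lra. }
  assert (hmono : forall r1 r2, 0 < r1 -> r1 <= r2 -> phi r1 <= phi r2).
  { intros r1 r2 h1 h2. destruct (Req_dec r1 r2) as [->|hne]; [lra|].
    destruct (MVT_gen phi r1 r2 (fun r => s * exp (s * ln r) / r * PSeries u (- r)))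
      as (c & hc & heq).
    - rewrite Rmin_left, Rmax_right by lra. intros x hx. apply hder. lra.
    - rewrite Rmin_left, Rmax_right by lra. intros x hx.
      apply continuity_pt_filterlim, (ex_derive_continuous phi).
      eexists. apply hder. lra.
    - rewrite Rmin_left, Rmax_right in hc by lra.
      assert (0 <= s * exp (s * ln c) / c * PSeries u (- c)).
      { apply Rmult_le_pos; [|apply hpos; lra].
        apply Rmult_le_pos; [|left; apply Rinv_0_lt_compat; lra].
        left. apply Rmult_lt_0_compat; [lra | apply exp_pos]. }
      assert (0 <= s * exp (s * ln c) / c * PSeries u (- c) * (r2 - r1))
        by (apply Rmult_le_pos; lra). lra. }
  assert (hv0 : 0 < PSeries v 0).
  { rewrite PSeries_0. unfold v. simpl. replace (u 0%nat * (s / (s + 0))) with (u 0%nat)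
      by (field; lra). exact hu0. }
  (* Strictness starts near the origin: continuity and [PSeries v 0 = u 0 > 0] give [phi r1 > 0] at
     some [r1 <= - z], and monotonicity carries this to [- z]. *)
  assert (hc : continuity_pt (PSeries v) 0).
  { apply PSeries_continuity. now apply exp_bounded_inside. }
  pose proof (proj1 (continuity_pt_locally _ _) hc) as hloc.
  destruct (hloc (mkposreal _ hv0)) as [d hd].
  pose (r1 := Rmin (d / 2) (- z)).
  assert (hr1 : 0 < r1 /\ r1 <= - z /\ r1 < d).
  { unfold r1. destruct d as [d hd']; simpl.
    pose proof (Rmin_l (d / 2) (- z)). pose proof (Rmin_r (d / 2) (- z)).
    split; [apply Rmin_glb_lt; lra | lra]. }
  assert (h1 : 0 < phi r1).
  { unfold phi. apply Rmult_lt_0_compat; [apply exp_pos|].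
    assert (hb : ball 0 d (- r1)).
    { unfold ball; simpl; unfold AbsRing_ball, abs, minus, plus, opp; simpl.
      rewrite Ropp_0, Rplus_0_r, Rabs_Ropp, Rabs_pos_eq; lra. }
    specialize (hd _ hb). simpl in hd. apply Rabs_def2 in hd. lra. }
  assert (h2 : phi r1 <= phi (- z)) by (apply hmono; lra).
  assert (h3 : 0 < phi (- z)) by lra. unfold phi in h3. rewrite Ropp_involutive in h3.
  apply Rmult_lt_reg_l with (exp (s * ln (- z))); [apply exp_pos | lra].
Qed.

(* [(c)_k (c'+N+1)_k / ((c')_k (c+N+1)_k)] arises from the same expression at [N] by multiplication
   with [(c+N) (c'+N+k) / ((c'+N) (c+N+k))], a convex combination of [1] and [(c+N)/(c+N+k)];
   the limit [N -> oo] leaves [(c)_k/(c')_k]. *)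
Lemma PSeries_raise_lower_parameter (u : nat -> R) (c c' : R) :
  0 < c -> c <= c' -> exp_bounded u -> 0 < u 0%nat ->
  (forall z, z < 0 -> 0 <= PSeries u z) ->
  forall z, z < 0 -> 0 <= PSeries (fun k => u k * (poch c k / poch c' k)) z.
Proof.
  intros hc hc' hu hu0 hpos z hz.
  pose (w := fun N k => u k * (poch c k / poch c' k)
                        * (poch (c' + INR N) k / poch (c + INR N) k)).
  assert (hp : forall N k, 0 < poch (c + INR N) k /\ 0 < poch (c' + INR N) k).
  { intros N k. pose proof (pos_INR N). split; apply poch_pos; lra. }
  assert (hp0 : forall k, 0 < poch c k /\ 0 < poch c' k) by (intros; split; apply poch_pos; lra).
  (* Each factor is at most 1, because $(c'+k)(c+N+k)-(c+k)(c'+N+k) = N(c'-c) \ge 0$. *)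
  assert (hr : forall N k, 0 <= poch c k / poch c' k * (poch (c' + INR N) k / poch (c + INR N) k) <= 1).
  { intros N k. induction k as [|k IH]; [simpl; lra|].
    cbn [poch]. pose proof (pos_INR N) as hN. pose proof (pos_INR k) as hk.
    pose proof (hp N k). pose proof (hp0 k).
    replace (poch c k * (c + INR k) / (poch c' k * (c' + INR k)) *
       (poch (c' + INR N) k * (c' + INR N + INR k) / (poch (c + INR N) k * (c + INR N + INR k))))
     with (poch c k / poch c' k * (poch (c' + INR N) k / poch (c + INR N) k) *
       ((c + INR k) * (c' + INR N + INR k) / ((c' + INR k) * (c + INR N + INR k))))
      by (field; lra).
    assert (hq : 0 <= (c + INR k) * (c' + INR N + INR k) / ((c' + INR k) * (c + INR N + INR k)) <= 1).
    { assert (0 < (c' + INR k) * (c + INR N + INR k)) by (apply Rmult_lt_0_compat; lra).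
      split.
      - apply Rmult_le_pos; [apply Rmult_le_pos; lra | left; now apply Rinv_0_lt_compat].
      - apply Rle_div_l; [lra|]. nra. }
    split; [apply Rmult_le_pos; lra|].
    replace 1 with (1 * 1) by ring. apply Rmult_le_compat; lra. }
  assert (hwb : forall N k, Rabs (w N k) <= Rabs (u k)).
  { intros N k. unfold w. rewrite Rmult_assoc, Rabs_mult. pose proof (hr N k).
    rewrite <- (Rmult_1_r (Rabs (u k))) at 2. apply Rmult_le_compat_l; [apply Rabs_pos|].
    rewrite Rabs_pos_eq; lra. }
  assert (hweb : forall N, exp_bounded (w N)).
  { intros N. apply (exp_bounded_le u); auto. }
  assert (hw : forall N y, y < 0 -> 0 <= PSeries (w N) y).
  { induction N as [|N IH]; intros y hy.
    - rewrite (PSeries_ext _ u); [now apply hpos|]. intros k. unfold w. simpl.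
      rewrite !Rplus_0_r. pose proof (hp0 k). field. lra.
    - pose proof (pos_INR N) as hN.
      (* The two weights sum to 1; the second series is the average of the first with
         [s = c + INR N]. *)
      rewrite (PSeries_ext _ (PS_plus (PS_scal ((c + INR N) / (c' + INR N)) (w N))
        (PS_scal ((c' - c) / (c' + INR N)) (fun k => w N k * ((c + INR N) / (c + INR N + INR k)))))).
      + assert (hav : 0 < PSeries (fun k => w N k * ((c + INR N) / (c + INR N + INR k))) y).
        { apply PSeries_average_pos; auto; [lra|]. unfold w; simpl. lra. }
        specialize (IH y hy).
        rewrite PSeries_plus, !PSeries_scal.
        * assert (0 < / (c' + INR N)) by (apply Rinv_0_lt_compat; lra).
          apply Rplus_le_le_0_compat; (apply Rmult_le_pos; [apply Rmult_le_pos|]); lra.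
        * apply ex_pseries_scal; [apply Rmult_comm|]. now apply CV_radius_inside, exp_bounded_inside.
        * apply ex_pseries_scal; [apply Rmult_comm|].
          apply CV_radius_inside, exp_bounded_inside, (exp_bounded_le (w N)); [auto|].
          intros k. pose proof (pos_INR k). rewrite Rabs_mult.
          rewrite <- (Rmult_1_r (Rabs (w N k))) at 2. apply Rmult_le_compat_l; [apply Rabs_pos|].
          rewrite Rabs_pos_eq.
          -- apply Rle_div_l; lra.
          -- apply Rmult_le_pos; [lra|]. left. apply Rinv_0_lt_compat. lra.
      + intros k. unfold PS_plus, PS_scal, plus, scal; simpl; unfold mult; simpl. unfold w.
        pose proof (pos_INR k). rewrite S_INR.
        assert (hsh : forall x, 0 < x -> poch (x + (INR N + 1)) k
                  = poch (x + INR N) k * (x + INR N + INR k) / (x + INR N)).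
        { intros x hx. apply (Rmult_eq_reg_l (x + INR N)); [|lra].
          replace (x + (INR N + 1)) with (x + INR N + 1) by ring.
          rewrite <- poch_S_l. cbn [poch]. field. lra. }
        rewrite !hsh by lra. pose proof (hp N k). pose proof (hp0 k). field. lra. }
  assert (hlim : is_lim_seq (fun N => PSeries (w N) z)
                   (PSeries (fun k => u k * (poch c k / poch c' k)) z)).
  { apply (PSeries_dominated_convergence w _ u); auto.
    intros k. unfold w.
    rewrite <- (Rmult_1_r (u k * (poch c k / poch c' k))) at 1.
    apply (is_lim_seq_scal_l _ _ (Finite 1)).
    induction k as [|k IH].
    - apply (is_lim_seq_ext (fun _ => 1)); [intros; simpl; field|]. apply is_lim_seq_const.
    - pose proof (pos_INR k) as hk.
      (* The new factor $(c'+N+k)/(c+N+k)$ is $1+(c'-c)/(c+k+N)$, which tends to 1. *)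
      apply (is_lim_seq_ext (fun N => poch (c' + INR N) k / poch (c + INR N) k
          * (1 + (c' - c) * / (c + INR k + INR N)))).
      { intros N. cbn [poch]. pose proof (hp N k). pose proof (pos_INR N). field. lra. }
      replace 1 with (1 * (1 + (c' - c) * 0)) at 1 by ring.
      apply is_lim_seq_mult'; [exact IH|].
      apply is_lim_seq_plus'; [apply is_lim_seq_const|].
      apply (is_lim_seq_scal_l _ _ (Finite 0)).
      replace (Finite 0) with (Rbar_inv p_infty) by reflexivity.
      apply is_lim_seq_inv; [|discriminate].
      eapply is_lim_seq_plus; [apply is_lim_seq_const | apply is_lim_seq_INR | reflexivity]. }
  apply (is_lim_seq_le (fun _ => 0) (fun N => PSeries (w N) z) 0
           (PSeries (fun k => u k * (poch c k / poch c' k)) z)); auto.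
  apply is_lim_seq_const.
Qed.

(** * Coefficients of 1F2 and of the normalized Bessel function *)

(** Coefficients in the variable [z = - x ^ 2 / 4], indexed by the lower parameter
    [beta = alpha + 1] of 0F1 instead of the order. *)
Definition bessel_coeff (beta : R) (k : nat) : R := / (INR (fact k) * poch beta k).

Definition coeff12 (a b c : R) (k : nat) : R :=
  poch a k / (INR (fact k) * poch b k * poch c k).

(** Up to a geometric factor $(b)_k$ absorbs $(a)_k$, and $1/(c)_k \le c^{-k}$; the factorial
    remains. *)
Lemma exp_bounded_coeff12 (a b c : R) : 0 < b -> 0 < c -> exp_bounded (coeff12 a b c).
Proof.
  intros hb hc. exists 1, ((Rabs a / b + 1) / c).
  assert (h0 : 0 <= (Rabs a / b + 1)).
  { pose proof (Rabs_pos a). apply Rplus_le_le_0_compat; [|lra].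
    apply Rmult_le_pos; [lra | left; now apply Rinv_0_lt_compat]. }
  repeat split; [lra | apply Rmult_le_pos; [lra | left; now apply Rinv_0_lt_compat] |].
  intros k. unfold coeff12.
  pose proof (poch_pos b k hb). pose proof (poch_pos c k hc).
  pose proof (INR_fact_lt_0 k). pose proof (pow_lt c k hc) as hck.
  assert (hd : 0 < INR (fact k) * poch b k * poch c k) by (repeat apply Rmult_lt_0_compat; auto).
  unfold Rdiv at 1. rewrite Rabs_mult, Rabs_inv, (Rabs_pos_eq (_ * _ * _)) by lra.
  rewrite <- Rdiv_def. apply Rle_div_l; [exact hd|].
  unfold Rdiv at 2. rewrite Rpow_mult_distr, pow_inv.
  replace (1 * ((Rabs a / b + 1) ^ k * / c ^ k) / INR (fact k) * (INR (fact k) * poch b k * poch c k))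
    with ((Rabs a / b + 1) ^ k * poch b k * (poch c k / c ^ k)) by (field; lra).
  rewrite <- (Rmult_1_r (Rabs (poch a k))).
  apply Rmult_le_compat; [apply Rabs_pos | lra | now apply poch_le_geom |].
  apply Rle_div_r; [exact hck|]. rewrite Rmult_1_l. now apply pow_le_poch.
Qed.

Lemma bessel_coeff_eq (a beta : R) (k : nat) :
  0 < a -> 0 < beta -> bessel_coeff beta k = coeff12 a a beta k.
Proof.
  intros ha hb. unfold bessel_coeff, coeff12.
  pose proof (poch_pos a k ha). pose proof (poch_pos beta k hb). pose proof (INR_fact_lt_0 k).
  field. lra.
Qed.

Lemma exp_bounded_bessel (beta : R) : 0 < beta -> exp_bounded (bessel_coeff beta).
Proof.
  intros hb. apply (exp_bounded_le (coeff12 1 1 beta)).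
  - now apply exp_bounded_coeff12; [lra|].
  - intros k. rewrite (bessel_coeff_eq 1) by lra. apply Rle_refl.
Qed.

Lemma F12_PSeries (a b c x : R) : F12 a b c x = PSeries (coeff12 a b c) (- x ^ 2 / 4).
Proof. reflexivity. Qed.

 
Lemma JJ_PSeries (alpha x : R) : JJ alpha x = PSeries (bessel_coeff (alpha + 1)) (- x ^ 2 / 4).
Proof. reflexivity. Qed.

Lemma F12_comm (a b c x : R) : F12 a b c x = F12 a c b x.
Proof.
  rewrite !F12_PSeries. apply PSeries_ext. intros k. unfold coeff12. f_equal. ring.
Qed.

(** * The Bessel equation, oscillation and zeros *)

(** The differential equation of 0F1 is the recurrence $(k+1)(\beta+k)g_{k+1} = g_k$. *)
Lemma bessel_PSeries_ode (beta z : R) : 0 < beta ->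
  let g := bessel_coeff beta in
  z * PSeries (PS_derive (PS_derive g)) z + beta * PSeries (PS_derive g) z = PSeries g z.
Proof.
  intros hb g. assert (hg : exp_bounded g) by now apply exp_bounded_bessel.
  rewrite <- PSeries_incr_1, <- !PSeries_scal, <- PSeries_plus.
  - apply PSeries_ext. intros k. match goal with |- ?l = ?r => change (@eq R l r) end.
    assert (hk : g (S k) * (INR k + 1) * (beta + INR k) = g k).
    { unfold g, bessel_coeff. cbn [poch]. rewrite fact_simpl, mult_INR, S_INR.
      pose proof (pos_INR k). pose proof (poch_pos beta k hb). pose proof (INR_fact_lt_0 k).
      field. lra. }
    rewrite <- hk.
    unfold PS_plus, PS_incr_1, PS_scal, PS_derive, plus, scal, zero; cbn -[INR]; unfold mult; cbn -[INR].
    destruct k as [|k]; [simpl; ring|]. rewrite !S_INR. ring.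
  - apply ex_pseries_incr_1, CV_radius_inside. rewrite !CV_radius_derive.
    now apply exp_bounded_inside.
  - apply ex_pseries_scal; [apply Rmult_comm|]. apply CV_radius_inside.
    rewrite CV_radius_derive. now apply exp_bounded_inside.
Qed.

(* Sturm comparison: [x^(alpha+1/2) * JJ alpha x] solves [u'' + (1 - (alpha^2-1/4)/x^2) u = 0], whose
   potential is eventually at least [1/4], the one of [sin ((x-l)/2)]; so [u] cannot be positive on a
   far interval of length [2 pi]. *)
 
Lemma JJ_nonpos_somewhere (alpha : R) : - 1 < alpha -> exists x, 0 < x /\ JJ alpha x <= 0.
Proof.
  intros halpha.
  destruct (Classical_Prop.classic (exists x, 0 < x /\ JJ alpha x <= 0)) as [h|hno]; [exact h|].
  exfalso.
  assert (hJ : forall x, 0 < x -> 0 < JJ alpha x).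
  { intros x hx. apply Rnot_le_lt. intros hle. apply hno. now exists x. }
  pose (g := bessel_coeff (alpha + 1)).
  assert (hg : exp_bounded g) by (apply exp_bounded_bessel; lra).
  pose (G := PSeries g). pose (G1 := PSeries (PS_derive g)).
  pose (G2 := PSeries (PS_derive (PS_derive g))).
  assert (dG : forall z, is_derive G z (G1 z)).
  { intros z. apply is_derive_PSeries. now apply exp_bounded_inside. }
  assert (dG1 : forall z, is_derive G1 z (G2 z)).
  { intros z. apply is_derive_PSeries. rewrite CV_radius_derive. now apply exp_bounded_inside. }
  pose (p := alpha + 1 / 2).
  (* Here $p(p-1) = \alpha^2-1/4$, and [l] is so large that $1-p(p-1)/x^2 \ge 1/4$ for $x \ge l$. *)
  pose (l := 1 + 2 * Rabs (p * (p - 1)) ).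
  assert (hl1 : 1 <= l) by (unfold l; pose proof (Rabs_pos (p * (p - 1))); lra).
  assert (hlp : p * (p - 1) <= 3 / 4 * (l * l)).
  { pose proof (Rle_abs (p * (p - 1))). pose proof (Rabs_pos (p * (p - 1))). unfold l. nra. }
  (* The Wronskian $u's-us'$ of $u = x^p\,\mathbb{J}_\alpha(x)$ and $s = \sin((x-l)/2)$; its
     derivative is $-(3/4-p(p-1)/x^2)\,us$. *)
  pose (W := fun x => exp (p * ln x) *
    ((p / x * G (- x ^ 2 / 4) - x / 2 * G1 (- x ^ 2 / 4)) * sin ((x - l) / 2)
     - G (- x ^ 2 / 4) * (cos ((x - l) / 2) / 2))).
  pose (W' := fun x => - (3 / 4 - p * (p - 1) / (x * x)) * exp (p * ln x)
                         * G (- x ^ 2 / 4) * sin ((x - l) / 2)).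
  assert (dW : forall x, 0 < x -> is_derive W x (W' x)).
  { intros x hx. unfold W.
    auto_derive.
    - repeat split; auto; try lra; eexists; eauto.
    - replace (- (x * (x * 1)) * / 4) with (- x ^ 2 / 4) by (simpl; field).
      rewrite (is_derive_unique _ _ _ (dG _)), (is_derive_unique _ _ _ (dG1 _)).
      unfold W'.
      pose proof (bessel_PSeries_ode (alpha + 1) (- x ^ 2 / 4)) as hode.
      cbv zeta in hode. fold g G G1 G2 in hode.
      assert (hb : 0 < alpha + 1) by lra. specialize (hode hb).
      replace (G (- x ^ 2 / 4)) with
        (- x ^ 2 / 4 * G2 (- x ^ 2 / 4) + (alpha + 1) * G1 (- x ^ 2 / 4)).
      unfold p. change ((x + - l) * / 2) with ((x - l) / 2).
      generalize (sin ((x - l) / 2)) (cos ((x - l) / 2)) (exp ((alpha + 1 / 2) * ln x))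
        (G1 (- x ^ 2 / 4)) (G2 (- x ^ 2 / 4)). intros. field. lra. }
  pose proof PI_RGT_0 as hpi.
  destruct (MVT_gen W l (l + 2 * PI) W') as (c & hc & heq).
  - rewrite Rmin_left, Rmax_right by lra. intros x hx. apply dW. lra.
  - rewrite Rmin_left, Rmax_right by lra. intros x hx.
    apply continuity_pt_filterlim, (ex_derive_continuous W). eexists. apply dW. lra.
  - rewrite Rmin_left, Rmax_right in hc by lra.
    assert (hle : W' c <= 0).
    { unfold W'.
      assert (0 <= sin ((c - l) / 2)) by (apply sin_ge_0; lra).
      assert (0 < G (- c ^ 2 / 4)) by (apply hJ; lra).
      pose proof (exp_pos (p * ln c)).
      assert (hcc : p * (p - 1) / (c * c) <= 3 / 4).
      { apply Rle_div_l; [nra|]. nra. }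
      assert (0 <= (3 / 4 - p * (p - 1) / (c * c)) * exp (p * ln c) * G (- c ^ 2 / 4) * sin ((c - l) / 2))
        by (repeat apply Rmult_le_pos; lra).
      lra. }
    (* At both ends $s = 0$ while $s' = \pm 1/2$, so [W] goes from negative to positive although
       [W' c <= 0]. *)
    assert (hl : W l < 0).
    { unfold W. replace ((l - l) / 2) with 0 by field. rewrite sin_0, cos_0.
      assert (0 < G (- l ^ 2 / 4)) by (apply hJ; lra). pose proof (exp_pos (p * ln l)). nra. }
    assert (hr : 0 < W (l + 2 * PI)).
    { unfold W. replace ((l + 2 * PI - l) / 2) with PI by field. rewrite sin_PI, cos_PI.
      assert (0 < G (- (l + 2 * PI) ^ 2 / 4)) by (apply hJ; lra).
      pose proof (exp_pos (p * ln (l + 2 * PI))). nra. }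
    nra.
Qed.

 
Lemma JJ_continuity (alpha x : R) : - 1 < alpha -> continuity_pt (JJ alpha) x.
Proof.
  intros ha. apply continuity_pt_filterlim, (ex_derive_continuous (JJ alpha)).
  apply (ex_derive_comp (PSeries (bessel_coeff (alpha + 1))) (fun x => - x ^ 2 / 4)).
  - apply ex_derive_PSeries, exp_bounded_inside, exp_bounded_bessel. lra.
  - auto_derive. exact I.
Qed.

 
Lemma JJ_0 (alpha : R) : JJ alpha 0 = 1.
Proof.
  rewrite JJ_PSeries. replace (- 0 ^ 2 / 4) with 0 by field.
  rewrite PSeries_0. unfold bessel_coeff. simpl. field.
Qed.

 
Lemma JJ_zero (alpha : R) : - 1 < alpha -> exists x, 0 < x /\ JJ alpha x = 0.
Proof.
  intros ha. destruct (JJ_nonpos_somewhere alpha ha) as (y & hy & hle).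
  destruct (Req_dec (JJ alpha y) 0) as [h0|hne]; [now exists y|].
  destruct (IVT (fun x => - JJ alpha x) 0 y) as (x & hx & h0).
  - intros x. apply continuity_pt_opp, JJ_continuity, ha.
  - exact hy.
  - rewrite JJ_0. lra.
  - lra.
  - exists x. split; [|lra]. destruct (Req_dec x 0) as [->|]; [rewrite JJ_0 in h0; lra | lra].
Qed.

(** * The square of a Bessel function as a 1F2 *)

(** Chu-Vandermonde, that is $(1-z)^{-x}(1-z)^{-y} = (1-z)^{-(x+y)}$; both sides satisfy
    $(n+1)s_{n+1} = (x+y+n)s_n$. *)
Lemma PS_mult_poch (x y : R) (n : nat) :
  PS_mult (fun i => poch x i / INR (fact i)) (fun i => poch y i / INR (fact i)) n
  = poch (x + y) n / INR (fact n).
Proof.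
  assert (hS : forall t i, poch t (S i) / INR (fact (S i)) * INR (S i)
                           = (t + INR i) * (poch t i / INR (fact i))).
  { intros t i. cbn [poch]. rewrite fact_simpl, mult_INR. field.
    split; [apply INR_fact_neq_0 | now apply not_0_INR]. }
  unfold PS_mult. induction n as [|n IH]; [simpl; field|].
  apply (Rmult_eq_reg_r (INR (S n))); [|now apply not_0_INR].
  rewrite hS, <- IH. clear IH.
  set (A := fun i => poch x i / INR (fact i)) in *. set (B := fun i => poch y i / INR (fact i)) in *.
  (* The weight [S n] is split as [i + (S n - i)], each part being absorbed by one of the two
     factors. *)
  transitivity (sum_f_R0 (fun i => A i * INR i * B (S n - i)%nat) (S n)
                + sum_f_R0 (fun i => A i * (B (S n - i)%nat * INR (S n - i))) (S n)).
  { rewrite <- plus_sum, Rmult_comm, scal_sum. apply sum_eq. intros i hi.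
    rewrite minus_INR by exact hi. unfold A, B. ring. }
  rewrite decomp_sum by lia. rewrite (tech5 _ n), Nat.sub_diag.
  simpl (INR 0). rewrite !Rmult_0_r, Rmult_0_l, Rplus_0_l, Rplus_0_r.
  simpl pred. rewrite <- plus_sum, scal_sum. apply sum_eq. intros i hi.
  change (S n - S i)%nat with (n - i)%nat. rewrite Nat.sub_succ_l by exact hi.
  pose proof (hS x i) as hA. pose proof (hS y (n - i)%nat) as hB.
  fold (A (S i)) (A i) in hA. fold (B (S (n - i))) (B (n - i)%nat) in hB.
  rewrite hA, hB, minus_INR by exact hi. unfold A, B. ring.
Qed.

(* Chu-Vandermonde at [1 - beta - k], using [(1 - beta - k)_i = (-1)^i (beta)_k / (beta)_(k-i)]. *)
Lemma PS_mult_bessel (a : R) (k : nat) : 0 < a ->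
  PS_mult (bessel_coeff (a + 1 / 2)) (bessel_coeff (a + 1 / 2)) k
  = 4 ^ k * coeff12 a (a + 1 / 2) (2 * a) k.
Proof.
  intros ha. set (beta := a + 1 / 2). assert (hb : 0 < beta) by (unfold beta; lra).
  pose proof (poch_pos beta k hb) as hk.
  assert (hs : forall i, (-1) ^ i <> 0) by (intros; apply pow_nonzero; lra).
  assert (hi : forall i, (i <= k)%nat ->
    poch (1 - beta - INR k) i = (-1) ^ i * (poch beta k / poch beta (k - i))).
  { intros i h.
    replace (1 - beta - INR k) with (1 - (beta + INR (k - i)) - INR i)
      by (rewrite minus_INR by exact h; ring).
    rewrite poch_reverse. f_equal.
    replace (poch beta k) with (poch beta ((k - i) + i)) by (f_equal; lia).
    rewrite poch_add. pose proof (poch_pos beta (k - i) hb). field. lra. }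
  pose proof (PS_mult_poch (1 - beta - INR k) (1 - beta - INR k) k) as hv.
  replace (1 - beta - INR k + (1 - beta - INR k)) with (1 - (2 * a + INR k) - INR k) in hv
    by (unfold beta; field).
  rewrite poch_reverse in hv.
  (* The Vandermonde sum yields $(2a+k)_k$; duplication of $(2a)_{2k}$ turns it into parameters of
     the 1F2. *)
  assert (hd : poch (2 * a) k * poch (2 * a + INR k) k = 4 ^ k * poch a k * poch beta k).
  { rewrite <- poch_add. apply poch_double. }
  assert (h2a : 0 < poch (2 * a) k) by (apply poch_pos; lra).
  assert (heq : PS_mult (fun i => poch (1 - beta - INR k) i / INR (fact i))
                  (fun i => poch (1 - beta - INR k) i / INR (fact i)) k
    = (-1) ^ k * (poch beta k * poch beta k)
      * PS_mult (bessel_coeff beta) (bessel_coeff beta) k).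
  { unfold PS_mult. rewrite scal_sum. apply sum_eq. intros i h.
    rewrite !hi by lia. replace (k - (k - i))%nat with i by lia.
    replace ((-1) ^ k) with ((-1) ^ i * (-1) ^ (k - i)) by (rewrite <- pow_add; f_equal; lia).
    unfold bessel_coeff.
    pose proof (poch_pos beta i hb). pose proof (poch_pos beta (k - i) hb).
    pose proof (INR_fact_lt_0 i). pose proof (INR_fact_lt_0 (k - i)). field. lra. }
  rewrite heq in hv. clear heq.
  pose proof (INR_fact_lt_0 k) as hf.
  apply (Rmult_eq_reg_l ((-1) ^ k * (poch beta k * poch beta k)));
    [|apply Rmult_integral_contrapositive_currified; [apply hs|]; nra].
  rewrite hv. unfold coeff12. fold beta.
  replace (poch (2 * a + INR k) k) with (4 ^ k * poch a k * poch beta k / poch (2 * a) k)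
    by (rewrite <- hd; field; lra).
  field. lra.
Qed.

(** The factor [4 ^ k] of the Cauchy product rescales the argument from [x / 2] to [x]. *)
Lemma JJ_sqr (a x : R) : 0 < a -> (JJ (a - 1 / 2) (x / 2)) ^ 2 = F12 a (a + 1 / 2) (2 * a) x.
Proof.
  intros ha. rewrite JJ_PSeries, F12_PSeries.
  replace (a - 1 / 2 + 1) with (a + 1 / 2) by field.
  assert (hg : exp_bounded (bessel_coeff (a + 1 / 2))) by (apply exp_bounded_bessel; lra).
  rewrite <- Rsqr_pow2. unfold Rsqr.
  rewrite <- PSeries_mult by now apply exp_bounded_inside.
  apply Series_ext. intros k. rewrite PS_mult_bessel by exact ha.
  replace ((- x ^ 2 / 4) ^ k) with (4 ^ k * (- (x / 2) ^ 2 / 4) ^ k).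
  - ring.
  - rewrite <- Rpow_mult_distr. f_equal. field.
Qed.

(** * Dougall's summation *)

(** For $a \ne 1/2$ this is the very-well-poised
    $\frac{2a-1+2n}{2a-1}\cdot\frac{(2a-1)_n(2a-b)_n(2a-c)_n}{n!\,(b)_n(c)_n}$. The case split
    cancels [2 * a - 1], so that [a = 1 / 2] is covered. *)
Definition wp_coeff (a b c : R) (n : nat) : R :=
  match n with
  | O => 1
  | S m => (2 * a + 1 + 2 * INR m) * poch (2 * a) m * poch (2 * a - b) n * poch (2 * a - c) n
           / (INR (fact n) * poch b n * poch c n)
  end.

(* Telescoping (Wilf-Zeilberger) form of Dougall's very-well-poised [5F4] summation. *)
Lemma wp_partial_sum (a b c : R) (k N : nat) :
  0 < a -> 0 < b -> 0 < c -> b + c = 3 * a + 1 / 2 ->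
  sum_f_R0 (fun n => poch (- INR (S k)) n * wp_coeff a b c n / poch (2 * a + INR (S k)) n) N =
  (a + 1 / 2 + INR k) * (2 * a + INR k) / ((b + INR k) * (c + INR k))
  * sum_f_R0 (fun n => poch (- INR k) n * wp_coeff a b c n / poch (2 * a + INR k) n) N
  + poch (- INR k) N * poch (2 * a) N * poch (2 * a - b) (S N) * poch (2 * a - c) (S N)
    / (INR (fact N) * poch b N * poch c N
       * poch (2 * a + INR (S k)) N * ((b + INR k) * (c + INR k))).
Proof.
  intros ha hb hc hbc. pose proof (pos_INR k) as hk.
  assert (Ec : c = 3 * a + 1 / 2 - b) by lra.
  induction N as [|N IH].
  - simpl. rewrite Ec in *. field. lra.
  - rewrite !tech5, IH. clear IH. pose proof (pos_INR N) as hN.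
    unfold wp_coeff.
    (* Both values of [k] are expressed through $(-k)_N$ and $(2a+k+1)_N$, which leaves a rational
       identity. *)
    replace (poch (- INR (S k)) (S N)) with (- (INR k + 1) * poch (- INR k) N).
    2:{ rewrite poch_S_l, S_INR. replace (- (INR k + 1) + 1) with (- INR k) by ring. ring. }
    replace (poch (2 * a + INR k) (S N)) with ((2 * a + INR k) * poch (2 * a + INR (S k)) N).
    2:{ rewrite poch_S_l, S_INR. do 2 f_equal. ring. }
    rewrite fact_simpl, mult_INR. cbn [poch]. rewrite !S_INR.
    assert (h1 : 0 < poch (2 * a + (INR k + 1)) N) by (apply poch_pos; lra).
    pose proof (poch_pos b N hb) as h2. pose proof (poch_pos c N hc) as h3.
    pose proof (INR_fact_lt_0 N) as h4.
    generalize dependent (poch (2 * a + (INR k + 1)) N). intros q1 h1.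
    generalize dependent (poch b N). intros q2 h2.
    generalize dependent (poch c N). intros q3 h3.
    generalize dependent (INR (fact N)). intros q4 h4.
    generalize (poch (- INR k) N) (poch (2 * a) N) (poch (2 * a - b) N) (poch (2 * a - c) N).
    intros r1 r2 r3 r4.
    match goal with |- context [sum_f_R0 ?f N] => generalize (sum_f_R0 f N) end. intros s.
    subst c. field. repeat split; lra.
Qed.

(** Dougall's value contains $(b+c-2a)_k$, here $(a+1/2)_k$. The result is the ratio of the
    coefficients of [F12 a b c] and [F12 a (a + 1 / 2) (2 * a)]. *)
Lemma wp_sum (a b c : R) (k N : nat) :
  0 < a -> 0 < b -> 0 < c -> b + c = 3 * a + 1 / 2 -> (k <= N)%nat ->
  sum_f_R0 (fun n => poch (- INR k) n * wp_coeff a b c n / poch (2 * a + INR k) n) N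
  = poch (a + 1 / 2) k * poch (2 * a) k / (poch b k * poch c k).
Proof.
  intros ha hb hc hbc.
  assert (hst : forall k N, (k <= N)%nat ->
    sum_f_R0 (fun n => poch (- INR k) n * wp_coeff a b c n / poch (2 * a + INR k) n) N =
    sum_f_R0 (fun n => poch (- INR k) n * wp_coeff a b c n / poch (2 * a + INR k) n) k).
  { clear k N. intros k N h. induction h as [|N h IH]; [reflexivity|].
    rewrite tech5, IH, poch_opp_nat_eq0 by lia. unfold Rdiv. ring. }
  intros hkN. rewrite hst by exact hkN. clear N hkN.
  induction k as [|k IH]; [simpl; field|].
  (* With upper limit [S k] the correction term contains $(-k)_{k+1} = 0$. *)
  rewrite wp_partial_sum, (poch_opp_nat_eq0 k (S k)), (hst k (S k)), IH by (auto; lia).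
  cbn [poch]. pose proof (pos_INR k) as hk.
  pose proof (poch_pos b k hb). pose proof (poch_pos c k hc).
  unfold Rdiv. rewrite !Rmult_0_l, Rplus_0_r. field. lra.
Qed.

(** * Gasper's expansion in squares of Bessel functions *)

(** Each numerator symbol is paired with $(b)_n$, $(c)_n$ or $n!$ at the cost of a geometric
    factor. *)
Lemma wp_coeff_bound (a b c : R) : 0 < a -> 0 < b -> 0 < c ->
  exists M, 1 <= M /\ forall n, Rabs (wp_coeff a b c n) <= M ^ n.
Proof.
  intros ha hb hc.
  assert (h1 : forall t y, 0 < y -> 1 <= Rabs t / y + 1).
  { intros t y hy. assert (0 <= Rabs t / y); [|lra].
    apply Rmult_le_pos; [apply Rabs_pos | left; now apply Rinv_0_lt_compat]. }
  pose proof (h1 (2 * a - b) b hb) as hB. pose proof (h1 (2 * a - c) c hc) as hC.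
  set (MB := Rabs (2 * a - b) / b + 1) in *. set (MC := Rabs (2 * a - c) / c + 1) in *.
  exists ((2 * a + 2) * (MB * MC)). split.
  { assert (1 <= MB * MC) by nra. nra. }
  intros [|m]; [simpl; rewrite Rabs_R1; lra|].
  unfold wp_coeff. set (n := S m).
  pose proof (pos_INR m) as hm.
  pose proof (poch_pos b n hb). pose proof (poch_pos c n hc). pose proof (INR_fact_lt_0 n) as hf.
  assert (hd : 0 < INR (fact n) * poch b n * poch c n)
    by (apply Rmult_lt_0_compat; [now apply Rmult_lt_0_compat | assumption]).
  unfold Rdiv. rewrite !Rabs_mult, Rabs_inv, (Rabs_pos_eq (INR (fact n) * _ * _)) by lra.
  rewrite <- Rdiv_def. apply Rle_div_l; [exact hd|].
  rewrite !Rpow_mult_distr.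
  assert (h2 : Rabs (2 * a + 1 + 2 * INR m) * Rabs (poch (2 * a) m)
               <= (2 * a + 2) ^ n * INR (fact n)).
  { rewrite Rabs_pos_eq by lra.
    assert (hp : Rabs (poch (2 * a) m) <= (2 * a + 2) ^ m * INR (fact m)).
    { rewrite <- poch_1. eapply Rle_trans; [apply (poch_le_geom _ 1); lra|].
      apply Rmult_le_compat_r; [left; apply poch_pos; lra|].
      apply pow_incr. rewrite Rabs_pos_eq by lra. lra. }
    unfold n. rewrite fact_simpl, mult_INR, S_INR. cbn [pow].
    replace ((2 * a + 2) * (2 * a + 2) ^ m * ((INR m + 1) * INR (fact m)))
      with ((2 * a + 2) * (INR m + 1) * ((2 * a + 2) ^ m * INR (fact m))) by ring.
    apply Rmult_le_compat; [lra | apply Rabs_pos | nra | exact hp]. }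
  replace ((2 * a + 2) ^ n * (MB ^ n * MC ^ n) * (INR (fact n) * poch b n * poch c n))
    with ((2 * a + 2) ^ n * INR (fact n) * (MB ^ n * poch b n) * (MC ^ n * poch c n)) by ring.
  apply Rmult_le_compat; [| apply Rabs_pos | | now apply poch_le_geom].
  { repeat apply Rmult_le_pos; apply Rabs_pos. }
  apply Rmult_le_compat; [| apply Rabs_pos | exact h2 | now apply poch_le_geom].
  apply Rmult_le_pos; apply Rabs_pos.
Qed.

Lemma poch_opp_ratio_le (a : R) (k n : nat) : 0 < a ->
  Rabs (poch (- INR k) n / poch (2 * a + INR k) n) <= 1.
Proof.
  intros ha. pose proof (pos_INR k) as hk.
  assert (hp : forall n, 0 < poch (2 * a + INR k) n) by (intros; apply poch_pos; lra).
  unfold Rdiv. rewrite Rabs_mult, Rabs_inv, (Rabs_pos_eq (poch (2 * a + INR k) n)) by (left; apply hp).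
  rewrite <- Rdiv_def. apply Rle_div_l; [apply hp|]. rewrite Rmult_1_l.
  induction n as [|n IH]; cbn [poch]; [rewrite Rabs_R1; lra|].
  pose proof (pos_INR n). rewrite Rabs_mult.
  apply Rmult_le_compat; [apply Rabs_pos | apply Rabs_pos | exact IH |].
  apply Rabs_le. lra.
Qed.

Lemma exp_bounded_geom (u : nat -> R) (r : R) : exp_bounded u -> exp_bounded (fun k => u k * r ^ k).
Proof.
  intros (K & M & hK & hM & h). exists K, (M * Rabs r).
  repeat split; [exact hK | apply Rmult_le_pos; [exact hM | apply Rabs_pos] |].
  intros k. rewrite Rabs_mult, <- RPow_abs, Rpow_mult_distr.
  replace (K * (M ^ k * Rabs r ^ k) / INR (fact k)) with (K * M ^ k / INR (fact k) * Rabs r ^ k)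
    by (field; apply INR_fact_neq_0).
  apply Rmult_le_compat_r; [apply pow_le, Rabs_pos | apply h].
Qed.

Lemma S_le_pow2 (k : nat) : INR k + 1 <= 2 ^ k.
Proof.
  induction k as [|k IH]; [simpl; lra|]. rewrite S_INR. cbn [pow]. pose proof (pos_INR k). lra.
Qed.

(** Writes the [n]-th square over the coefficients of the zeroth one, so that the expansion can be
    summed coefficientwise. The vanishing of $(-k)_n$ for $k < n$ encodes the shift by $z^n$. *)
Lemma JJ_sqr_shift_PSeries (a x : R) (n : nat) : 0 < a ->
  (x ^ 2 / 16) ^ n / poch (a + 1 / 2) n ^ 2 * JJ (a - 1 / 2 + INR n) (x / 2) ^ 2
  = PSeries (fun k => coeff12 a (a + 1 / 2) (2 * a) k
                      * (poch (- INR k) n / poch (2 * a + INR k) n)) (- x ^ 2 / 4).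
Proof.
  intros ha. pose proof (pos_INR n) as hn.
  replace (a - 1 / 2 + INR n) with (a + INR n - 1 / 2) by ring.
  rewrite JJ_sqr by lra. rewrite F12_PSeries.
  set (e := coeff12 (a + INR n) (a + INR n + 1 / 2) (2 * (a + INR n))).
  assert (hb : 0 < poch (a + 1 / 2) n) by (apply poch_pos; lra).
  assert (h4 : 0 < 4 ^ n) by (apply pow_lt; lra).
  transitivity (PSeries (PS_scal ((- 1) ^ n / (4 ^ n * poch (a + 1 / 2) n ^ 2)) (PS_incr_n e n))
                  (- x ^ 2 / 4)).
  - rewrite PSeries_scal, PSeries_incr_n.
    replace (x ^ 2 / 16) with (- 1 * (- x ^ 2 / 4) * / 4) by field.
    generalize (- x ^ 2 / 4) as z. intros z.
    rewrite !Rpow_mult_distr, pow_inv. field. lra.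
  - apply PSeries_ext. intros k. unfold PS_scal, scal; simpl; unfold mult; simpl.
    rewrite PS_incr_n_simplify.
    destruct (Compare_dec.le_lt_dec n k) as [hle|hlt].
    2:{ rewrite poch_opp_nat_eq0 by exact hlt. unfold zero; simpl. unfold Rdiv. ring. }
    replace k with (n + (k - n))%nat by lia. set (j := (k - n)%nat). clearbody j. clear k hle.
    replace (n + j - n)%nat with j by lia.
    pose proof (pos_INR j) as hj.
    unfold e, coeff12.
    pose proof (poch_opp_nat n j) as h1.
    pose proof (INR_fact_lt_0 j) as hfj. pose proof (INR_fact_lt_0 (n + j)) as hfn.
    (* Both sides are $(2a)_{2n+j}$, split at $n+j$ on the left and at $2n$, with duplication, on
       the right. *)
    assert (h2 : poch (2 * a) (n + j) * poch (2 * a + INR (n + j)) n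
                 = 4 ^ n * poch a n * poch (a + 1 / 2) n * poch (2 * (a + INR n)) j).
    { rewrite <- poch_add, <- poch_double.
      replace (n + j + n)%nat with (n + n + j)%nat by lia. rewrite poch_add. do 2 f_equal.
      rewrite plus_INR. ring. }
    replace (a + INR n + 1 / 2) with (a + 1 / 2 + INR n) by ring.
    rewrite !(poch_add _ n j).
    rewrite !(poch_add _ n j) in h2.
    assert (p1 : 0 < poch a n) by (apply poch_pos; lra).
    assert (p2 : 0 < poch (a + INR n) j) by (apply poch_pos; lra).
    assert (p3 : 0 < poch (a + 1 / 2 + INR n) j) by (apply poch_pos; lra).
    assert (p4 : 0 < poch (2 * a) n) by (apply poch_pos; lra).
    assert (p5 : 0 < poch (2 * a + INR n) j) by (apply poch_pos; lra).
    assert (p6 : 0 < poch (2 * (a + INR n)) j) by (apply poch_pos; lra).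
    assert (p7 : 0 < poch (2 * a + INR (n + j)) n) by (apply poch_pos; rewrite plus_INR; lra).
    replace (poch (- INR (n + j)) n) with ((-1) ^ n * INR (fact (n + j)) / INR (fact j))
      by (rewrite <- h1; field; lra).
    transitivity ((-1) ^ n * (poch a n * poch (a + INR n) j)
      / (INR (fact j) * (poch (a + 1 / 2) n * poch (a + 1 / 2 + INR n) j)
         * (poch (2 * a) n * poch (2 * a + INR n) j * poch (2 * a + INR (n + j)) n))).
    { rewrite h2. field. lra. }
    field. lra.
Qed.

(* Gasper's expansion in squares of Bessel functions. On the line [b + c = 3a + 1/2] its
   coefficients, in general terminating [4F3] sums, factor. *)
Lemma F12_sum_of_squares (a b c x : R) :
  0 < a -> 0 < b -> 0 < c -> b + c = 3 * a + 1 / 2 ->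
  is_series (fun n => wp_coeff a b c n
    * ((x ^ 2 / 16) ^ n / poch (a + 1 / 2) n ^ 2 * JJ (a - 1 / 2 + INR n) (x / 2) ^ 2))
    (F12 a b c x).
Proof.
  intros ha hb hc hbc.
  set (q := coeff12 a (a + 1 / 2) (2 * a)).
  assert (hq : exp_bounded q) by (apply exp_bounded_coeff12; lra).
  destruct (wp_coeff_bound a b c ha hb hc) as (M & hM & hwp).
  pose (t := fun k n => poch (- INR k) n * wp_coeff a b c n / poch (2 * a + INR k) n).
  (* [w N] holds the power series coefficients of the [N]-th partial sum of the expansion. *)
  pose (w := fun N k => q k * sum_f_R0 (t k) N).
  assert (hp : forall k n, 0 < poch (2 * a + INR k) n).
  { intros k n. pose proof (pos_INR k). apply poch_pos; lra. }
  assert (ht : forall k n, Rabs (t k n) <= if Compare_dec.le_lt_dec n k then M ^ k else 0).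
  { intros k n. unfold t. destruct (Compare_dec.le_lt_dec n k) as [hle|hlt].
    - replace (poch (- INR k) n * wp_coeff a b c n / poch (2 * a + INR k) n)
        with (poch (- INR k) n / poch (2 * a + INR k) n * wp_coeff a b c n)
        by (field; specialize (hp k n); lra).
      rewrite Rabs_mult, <- (Rmult_1_l (M ^ k)).
      apply Rmult_le_compat; try apply Rabs_pos; [now apply poch_opp_ratio_le|].
      eapply Rle_trans; [apply hwp | now apply Rle_pow].
    - rewrite poch_opp_nat_eq0 by exact hlt. unfold Rdiv. rewrite !Rmult_0_l, Rabs_R0. lra. }
  assert (hMk : forall k, 0 <= M ^ k) by (intros; apply pow_le; lra).
  (* At most [k + 1] terms are nonzero, each at most [M ^ k], and [k + 1 <= 2 ^ k]. *)
  assert (hs : forall k N, Rabs (sum_f_R0 (t k) N) <= (2 * M) ^ k).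
  { intros k N.
    assert (h1 : Rabs (sum_f_R0 (t k) N) <= (INR (Nat.min N k) + 1) * M ^ k).
    { induction N as [|N IH].
      - simpl. eapply Rle_trans; [apply ht|]. destruct (Compare_dec.le_lt_dec 0 k); [lra|lia].
      - rewrite tech5. eapply Rle_trans; [apply Rabs_triang|]. specialize (ht k (S N)).
        destruct (Compare_dec.le_lt_dec (S N) k) as [hle|hlt].
        + rewrite Nat.min_l in * by lia. rewrite S_INR. lra.
        + rewrite Nat.min_r in * by lia. lra. }
    eapply Rle_trans; [exact h1|]. rewrite Rpow_mult_distr.
    apply Rmult_le_compat_r; [apply hMk|].
    eapply Rle_trans; [|apply S_le_pow2]. apply Rplus_le_compat_r, le_INR. lia. }
  pose (u := fun k => q k * (2 * M) ^ k).
  assert (hu : exp_bounded u) by now apply exp_bounded_geom.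
  assert (hwu : forall N k, Rabs (w N k) <= Rabs (u k)).
  { intros N k. unfold w, u. rewrite !Rabs_mult. apply Rmult_le_compat_l; [apply Rabs_pos|].
    eapply Rle_trans; [apply hs | apply Rle_abs]. }
  assert (hterm : forall n, wp_coeff a b c n
    * ((x ^ 2 / 16) ^ n / poch (a + 1 / 2) n ^ 2 * JJ (a - 1 / 2 + INR n) (x / 2) ^ 2)
    = PSeries (fun k => q k * t k n) (- x ^ 2 / 4)).
  { intros n. rewrite JJ_sqr_shift_PSeries by exact ha. rewrite <- PSeries_scal.
    apply PSeries_ext. intros k. unfold PS_scal, scal; simpl; unfold mult; simpl.
    fold q. unfold t. specialize (hp k n). field. lra. }
  assert (hsum : forall N, sum_n (fun n => wp_coeff a b c n
    * ((x ^ 2 / 16) ^ n / poch (a + 1 / 2) n ^ 2 * JJ (a - 1 / 2 + INR n) (x / 2) ^ 2)) N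
    = PSeries (w N) (- x ^ 2 / 4)).
  { induction N as [|N IH].
    - rewrite sum_O. apply hterm.
    - rewrite sum_Sn, IH, hterm. unfold plus; simpl. rewrite <- PSeries_plus.
      + apply PSeries_ext. intros k. unfold PS_plus, plus, w; simpl. ring.
      + apply CV_radius_inside, exp_bounded_inside, (exp_bounded_le u); auto.
      + apply CV_radius_inside, exp_bounded_inside, (exp_bounded_le u); auto.
        intros k. unfold u. rewrite !Rabs_mult. apply Rmult_le_compat_l; [apply Rabs_pos|].
        eapply Rle_trans; [apply ht|]. eapply Rle_trans; [|apply Rle_abs].
        rewrite Rpow_mult_distr. pose proof (hMk k).
        assert (1 <= 2 ^ k) by (apply pow_R1_Rle; lra).
        destruct (Compare_dec.le_lt_dec (S N) k); nra. }
  apply (is_lim_seq_ext (fun N => PSeries (w N) (- x ^ 2 / 4)) _ (Finite (F12 a b c x)));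
    [intros N; now rewrite hsum|].
  rewrite F12_PSeries. apply (PSeries_dominated_convergence w _ u); auto.
  intros k. apply (is_lim_seq_ext_loc (fun _ => coeff12 a b c k)); [|apply is_lim_seq_const].
  (* From [N = k] on the terminating sum is complete, so the coefficient no longer changes. *)
  exists k. intros N hN. unfold w, t. rewrite wp_sum by auto. unfold q, coeff12.
  pose proof (poch_pos b k hb). pose proof (poch_pos c k hc). pose proof (INR_fact_lt_0 k).
  assert (0 < poch (a + 1 / 2) k) by (apply poch_pos; lra).
  assert (0 < poch (2 * a) k) by (apply poch_pos; lra).
  field. lra.
Qed.

(** * The lower bound by the leading square *)

(** Only the first factors of $(2a-b)_{n+1}$ and $(2a-c)_{n+1}$ can fail to be positive. *)
Lemma wp_coeff_sign (a b c : R) (n : nat) :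
  0 < a -> 0 < b -> 0 < c -> - 1 < 2 * a - b -> - 1 < 2 * a - c ->
  exists d, 0 < d /\ wp_coeff a b c (S n) = d * ((2 * a - b) * (2 * a - c)).
Proof.
  intros ha hb hc hB hC.
  exists ((2 * a + 1 + 2 * INR n) * poch (2 * a) n * poch (2 * a - b + 1) n * poch (2 * a - c + 1) n
           / (INR (fact (S n)) * poch b (S n) * poch c (S n))).
  split.
  - pose proof (pos_INR n).
    apply Rdiv_lt_0_compat.
    + repeat apply Rmult_lt_0_compat; try (apply poch_pos; lra); lra.
    + apply Rmult_lt_0_compat; [apply Rmult_lt_0_compat|]; try (apply poch_pos; lra).
      apply INR_fact_lt_0.
  - unfold wp_coeff. rewrite !(poch_S_l (2 * a - _)). unfold Rdiv. ring.
Qed.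

Lemma poch_le (x y : R) (n : nat) : 0 < x -> x <= y -> poch x n <= poch y n.
Proof.
  intros hx hxy. induction n as [|n IH]; cbn [poch]; [lra|].
  pose proof (pos_INR n). pose proof (poch_pos x n hx).
  apply Rmult_le_compat; lra.
Qed.

(** All coefficients but the zeroth tend to 0, dominated by those of order [alpha]. This provides a
    nonzero square of high order, hence strictness of the lower bound. *)
Lemma is_lim_seq_JJ_order (alpha x : R) : - 1 < alpha ->
  is_lim_seq (fun n => JJ (alpha + INR n) x) 1.
Proof.
  intros ha.
  pose (e := fun k : nat => match k with O => 1 | S _ => 0 end).
  pose (z := - x ^ 2 / 4).
  assert (hbd : exp_bounded (bessel_coeff (alpha + 1))) by (apply exp_bounded_bessel; lra).
  assert (hle : forall n k, Rabs (bessel_coeff (alpha + INR n + 1) k)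
                            <= Rabs (bessel_coeff (alpha + 1) k)).
  { intros n k. unfold bessel_coeff. pose proof (pos_INR n). pose proof (INR_fact_lt_0 k).
    assert (0 < poch (alpha + 1) k) by (apply poch_pos; lra).
    assert (poch (alpha + 1) k <= poch (alpha + INR n + 1) k) by (apply poch_le; lra).
    assert (h0 : 0 < INR (fact k) * poch (alpha + 1) k) by (apply Rmult_lt_0_compat; lra).
    assert (h1 : INR (fact k) * poch (alpha + 1) k <= INR (fact k) * poch (alpha + INR n + 1) k)
      by (apply Rmult_le_compat_l; lra).
    rewrite !Rabs_pos_eq by (left; apply Rinv_0_lt_compat; lra).
    now apply Rinv_le_contravar. }
  assert (hinv : forall k, is_lim_seq (fun n => / poch (alpha + INR n + 1) k) (e k)).
  { induction k as [|k IH].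
    - apply (is_lim_seq_ext (fun _ => 1)); [intros; simpl; field | apply is_lim_seq_const].
    - apply (is_lim_seq_ext (fun n => / poch (alpha + INR n + 1) k * / (alpha + 1 + INR k + INR n))).
      { intros n. cbn [poch]. rewrite <- Rinv_mult. do 2 f_equal. ring. }
      replace (Finite (e (S k))) with (Finite (e k * 0)) by (f_equal; simpl; ring).
      apply is_lim_seq_mult'; [exact IH|].
      replace (Finite 0) with (Rbar_inv p_infty) by reflexivity.
      apply is_lim_seq_inv; [|discriminate].
      eapply is_lim_seq_plus; [apply is_lim_seq_const | apply is_lim_seq_INR | reflexivity]. }
  assert (he : PSeries e z = 1).
  { rewrite PSeries_decr_1.
    - rewrite (PSeries_ext (PS_decr_1 e) (fun _ => 0)) by reflexivity.
      rewrite PSeries_const_0. simpl. ring.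
    - apply CV_radius_inside, exp_bounded_inside.
      apply (exp_bounded_le (bessel_coeff (alpha + 1))); [exact hbd|].
      intros [|k]; simpl e; [|rewrite Rabs_R0; apply Rabs_pos].
      unfold bessel_coeff. simpl. right. f_equal. field. }
  rewrite <- he.
  apply (PSeries_dominated_convergence (fun n => bessel_coeff (alpha + INR n + 1)) e
           (bessel_coeff (alpha + 1))); [exact hbd | exact hle |].
  intros k.
  apply (is_lim_seq_ext (fun n => / INR (fact k) * / poch (alpha + INR n + 1) k)).
  { intros n. unfold bessel_coeff. now rewrite Rinv_mult. }
  replace (e k) with (/ INR (fact k) * e k).
  - apply (is_lim_seq_scal_l _ _ (Finite (e k))), hinv.
  - destruct k as [|k]; [simpl; field | apply Rmult_0_r].
Qed.

Lemma F12_gt_JJ_sqr (a b c x : R) :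
  0 < a -> 0 < b -> 0 < c -> b + c = 3 * a + 1 / 2 ->
  0 < (2 * a - b) * (2 * a - c) -> 0 < x -> JJ (a - 1 / 2) (x / 2) ^ 2 < F12 a b c x.
Proof.
  intros ha hb hc hbc hBC hx.
  (* The two numbers have the same sign and their sum is $a-1/2 > -1/2$. *)
  assert (hB : - 1 < 2 * a - b) by nra. assert (hC : - 1 < 2 * a - c) by nra.
  pose proof (F12_sum_of_squares a b c x ha hb hc hbc) as hs.
  set (t := fun n => _) in hs.
  assert (hpos : forall n, exists d, 0 < d /\ t n = d * JJ (a - 1 / 2 + INR n) (x / 2) ^ 2).
  { intros n. exists (wp_coeff a b c n * ((x ^ 2 / 16) ^ n / poch (a + 1 / 2) n ^ 2)).
    split; [|unfold t; ring].
    apply Rmult_lt_0_compat.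
    - destruct n as [|n]; [simpl; lra|].
      destruct (wp_coeff_sign a b c n ha hb hc hB hC) as (d & hd & ->).
      now apply Rmult_lt_0_compat.
    - apply Rdiv_lt_0_compat; apply pow_lt; [nra|]. apply poch_pos. lra. }
  assert (hnn : forall n, 0 <= t n).
  { intros n. destruct (hpos n) as (d & hd & ->). apply Rmult_le_pos; [lra | apply pow2_ge_0]. }
  assert (hlim : is_lim_seq (fun n => JJ (a - 1 / 2 + INR n) (x / 2)) 1)
    by (apply is_lim_seq_JJ_order; lra).
  apply is_lim_seq_spec in hlim.
  (* The index [S m] keeps the strictly positive term apart from the leading one. *)
  destruct (hlim (mkposreal 1 Rlt_0_1)) as [m hm]. specialize (hm (S m) (le_S _ _ (le_n m))).
  change (pos (mkposreal 1 Rlt_0_1)) with 1 in hm. apply Rabs_def2 in hm.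
  assert (htm : 0 < t (S m)).
  { destruct (hpos (S m)) as (d & hd & ->). apply Rmult_lt_0_compat; [exact hd|].
    apply pow_lt. lra. }
  assert (hle : sum_n t (S m) <= F12 a b c x).
  { apply (is_lim_seq_incr_compare (sum_n t)); [exact hs|].
    intros n. rewrite sum_Sn. specialize (hnn (S n)). unfold plus; simpl. lra. }
  assert (h0 : t 0%nat <= sum_n t m).
  { clear - hnn. induction m as [|m IH]; [rewrite sum_O; lra|].
    rewrite sum_Sn. specialize (hnn (S m)). unfold plus; simpl. lra. }
  rewrite sum_Sn in hle. unfold plus in hle; simpl in hle.
  assert (ht0 : t 0%nat = JJ (a - 1 / 2) (x / 2) ^ 2).
  { unfold t. simpl. rewrite Rplus_0_r. field. }
  lra.
Qed.

(** * Failure of positivity outside the range *)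

Lemma P12_comm (a b c : R) : P12 a b c -> P12 a c b.
Proof.
  intros (ha & hb & hc & h). repeat split; auto. intros x hx. rewrite F12_comm. auto.
Qed.

(** At twice a zero of [JJ (a - 1 / 2)] the leading square vanishes and every other term is
    nonpositive. *)
Lemma not_P12_opposite_signs (a b c : R) :
  b + c = 3 * a + 1 / 2 -> - 1 < 2 * a - b -> - 1 < 2 * a - c ->
  (2 * a - b) * (2 * a - c) <= 0 -> ~ P12 a b c.
Proof.
  intros hbc hB hC hBC (ha & hb & hc & hP).
  destruct (JJ_zero (a - 1 / 2)) as (y & hy & h0); [lra|].
  specialize (hP (2 * y) ltac:(lra)).
  pose proof (F12_sum_of_squares a b c (2 * y) ha hb hc hbc) as hs.
  set (t := fun n => _) in hs.
  assert (hle : forall n, sum_n t n <= 0).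
  { induction n as [|n IH].
    - rewrite sum_O. unfold t. simpl (INR 0). rewrite Rplus_0_r.
      replace (2 * y / 2) with y by field. rewrite h0. simpl. lra.
    - rewrite sum_Sn. unfold plus; simpl.
      assert (hn : t (S n) <= 0); [|lra].
      unfold t. destruct (wp_coeff_sign a b c n ha hb hc hB hC) as (d & hd & ->).
      set (s := _ / _ * _ ^ 2).
      assert (hs0 : 0 <= s).
      { unfold s. apply Rmult_le_pos; [|apply pow2_ge_0].
        apply Rmult_le_pos; [apply pow_le; nra|].
        left. apply Rinv_0_lt_compat, pow_lt, poch_pos. lra. }
      assert (0 <= d * s) by (apply Rmult_le_pos; lra). nra. }
  assert (F12 a b c (2 * y) <= 0); [|lra].
  apply (is_lim_seq_le (sum_n t) (fun _ => 0) (F12 a b c (2 * y)) 0); auto.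
  apply is_lim_seq_const.
Qed.

(* Raising [c] to [a] only gives [JJ (b - 1) >= 0]; averaging once more gives [JJ b > 0]. *)
Lemma not_P12_le (a b c : R) : c <= a -> ~ P12 a b c.
Proof.
  intros hca (ha & hb & hc & hP).
  assert (hsub : forall z, z < 0 -> 0 < sqrt (- 4 * z) /\ - sqrt (- 4 * z) ^ 2 / 4 = z).
  { intros z hz. split; [apply sqrt_lt_R0; lra|]. rewrite pow2_sqrt by lra. field. }
  assert (h1 : forall z, z < 0 -> 0 <= PSeries (bessel_coeff b) z).
  { intros z hz.
    (* Once raised to [a], the lower parameter cancels the upper one and leaves 0F1 with parameter
       [b]. *)
    rewrite (PSeries_ext _ (fun k => coeff12 a b c k * (poch c k / poch a k))).
    - apply PSeries_raise_lower_parameter; auto.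
      + now apply exp_bounded_coeff12.
      + unfold coeff12. simpl. lra.
      + intros y hy. destruct (hsub y hy) as [h3 <-]. left. now apply hP.
    - intros k. unfold bessel_coeff, coeff12.
      pose proof (poch_pos a k ha). pose proof (poch_pos b k hb). pose proof (poch_pos c k hc).
      pose proof (INR_fact_lt_0 k). field. lra. }
  destruct (JJ_nonpos_somewhere b) as (x & hx & hle); [lra|].
  assert (h2 : 0 < PSeries (bessel_coeff (b + 1)) (- x ^ 2 / 4)); [|rewrite JJ_PSeries in hle; lra].
  (* Averaging with [s = b] replaces $(b)_k$ by $(b+1)_k$, raising the order by one. *)
  rewrite (PSeries_ext _ (fun k => bessel_coeff b k * (b / (b + INR k)))).
  - apply PSeries_average_pos; auto.
    + now apply exp_bounded_bessel.
    + unfold bessel_coeff. simpl. lra.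
    + nra.
  - intros k. unfold bessel_coeff.
    pose proof (poch_S_l b k) as h3. cbn [poch] in h3. pose proof (pos_INR k).
    pose proof (poch_pos b k hb). pose proof (INR_fact_lt_0 k).
    replace (poch (b + 1) k) with (poch b k * (b + INR k) / b) by (rewrite h3; field; lra).
    field. lra.
Qed.

(** * Locating the parameters and combining both directions *)

Theorem theorem3 (a b : R) (ha : 0 < a) (hb : 0 < b) :
  (P12 a b (3 * a + 1 / 2 - b) <->
     (a <> 1 / 2 /\ Rmin (a + 1 / 2) (2 * a) < b /\ b < Rmax (a + 1 / 2) (2 * a)))
  /\
  (P12 a b (3 * a + 1 / 2 - b) ->
     forall x : R, 0 < x ->
       F12 a b (3 * a + 1 / 2 - b) x > (JJ (a - 1 / 2) (x / 2)) ^ 2).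
Proof.
  set (c := 3 * a + 1 / 2 - b).
  assert (hbc : b + c = 3 * a + 1 / 2) by (unfold c; ring).
  (* Since $2a-c = b-(a+1/2)$, the product is positive exactly when [b] lies strictly between the
     two endpoints. *)
  assert (hin : (a <> 1 / 2 /\ Rmin (a + 1 / 2) (2 * a) < b /\ b < Rmax (a + 1 / 2) (2 * a))
                <-> 0 < (2 * a - b) * (2 * a - c)).
  { unfold c, Rmin, Rmax. destruct (Rle_dec (a + 1 / 2) (2 * a)); split.
    - intros (h & h1 & h2). nra.
    - intros h. assert (a + 1 / 2 < b) by nra. assert (b < 2 * a) by nra. repeat split; lra.
    - intros (h & h1 & h2). nra.
    - intros h. assert (b < a + 1 / 2) by nra. assert (2 * a < b) by nra. repeat split; lra. }
  assert (hnec : P12 a b c -> 0 < (2 * a - b) * (2 * a - c)).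
  { intros hP. apply Rnot_le_lt. intros hle.
    (* If $2a-b \le -1$ then $c \le a-1/2$; symmetrically for $c$ and $b$. *)
    destruct (Rle_lt_dec (2 * a - b) (- 1)) as [hB|hB].
    - apply (not_P12_le a b c); [lra | exact hP].
    - destruct (Rle_lt_dec (2 * a - c) (- 1)) as [hC|hC].
      + apply (not_P12_le a c b); [lra | now apply P12_comm].
      + now apply (not_P12_opposite_signs a b c). }
  split; [rewrite hin; split; [exact hnec|]|].
  (* [c] is the reflection of [b] in the interval with positive endpoints $a+1/2$ and $2a$. *)
  - intros hBC. assert (hc : 0 < c) by nra.
    repeat split; auto. intros x hx.
    eapply Rle_lt_trans; [apply pow2_ge_0 | now apply (F12_gt_JJ_sqr a b c)].
  - intros hP x hx. pose proof (hnec hP) as hBC. destruct hP as (_ & _ & hc & _).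
    now apply (F12_gt_JJ_sqr a b c).
Qed.
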